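(* Let $X=\{-1,-2,-3,\dots\}$. For an integer $a\ge 1$, let $f_a:\mathbb{C}\to\mathbb{C}$ be given by $f_a(x)=\dfrac{1}{x^a}$ for $x\neq0$ and $f_a(0)=0$, and let $f_a':\mathbb{C}\to\mathbb{C}$ be given by $f_a'(x)=-\dfrac{a}{x^{a+1}}$ for $x\ne0$ and $f_a'(0)=0$. If there exists a summable set $\mathcal{U}$ such that $\{f_a,f_a'\}\subset\mathbf{S}(\mathcal{U})$, then $\mathrm{ess}(f_a)=a\,\zeta(a+1)$ and $$\frac{d}{dx}\,\Sigma_{\mathcal{U}}(f_a;1,x)=\mathrm{ess}(f_a)+\Sigma_{\mathcal{U}}(f_a';1,x)$$ for all $x\in\mathbb{C}\setminus X$. Here $\zeta$ is the Riemann zeta function and $\mathrm{ess}$ is the essence relative to $\mathcal{U}$.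
   Context: Sets of functions. $\mathbb{C}^{\mathbb{C}}$ is the set of all functions $\mathbb{C}\to\mathbb{C}$. For $X\subset\mathbb{C}^{\mathbb{C}}$: $\mathbf{L}(X)$ is the set of all (finite, complex) linear combinations of functions in $X$; $\mathbf{T}(X)$ is the set of all translates $x\mapsto g(x+c)$ with $g\in X$, $c\in\mathbb{C}$; and $\mathbf{S}(X):=\mathbf{L}(\mathbf{T}(X))$. Polynomial sums. For a complex polynomial $p$, let $P$ be the unique polynomial with $P(z)-P(z-1)=p(z)$ for all $z$ and $P(0)=0$; the fractional sum of $p$ from $x$ to $y$ is $P(y)-P(x-1)$, for $x,y\in\mathbb{C}$. Fractional summable functions. $f:\mathbb{C}\to\mathbb{C}$ is fractional summable if there are a degree bound $m$ and a sequence $(p_n)_{n\in\mathbb{N}}$ of polynomials of degree $\le m$ (the null polynomial has degree $-\infty$) such that $|f(n+x)-p_n(n+x)|\to 0$ as $n\to\infty$ for all $x\in\mathbb{C}$, and such that for all $x,y\in\mathbb{C}$ the limit as $n\to\infty$ of (fractional sum of $p_n$ from $n+x$ to $n+y$) $+\sum_{\nu=1}^n\bigl(f(\nu+x-1)-f(\nu+y)\bigr)$ exists. $\mathcal{F}$ is the set of functions $\mathbb{C}\to\mathbb{C}$ that are linear combinations of holomorphic (entire) functions and fractional summable functions. Summable sets. A set $\mathcal{U}\subset\mathcal{F}$ is a summable set if there is a unique map $\Sigma_{\mathcal{U}}:\mathbf{S}(\mathcal{U})\times\mathbb{C}^2\to\mathbb{C}$, $(f,x,y)\mapsto\Sigma_{\mathcal{U}}(f;x,y)$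 (thought of as ''$\sum_{k=x}^y f(k)$''), satisfying, for all $f,g\in\mathbf{S}(\mathcal{U})$ and $x,y,z,s,\lambda,\mu\in\mathbb{C}$: (A1) $\Sigma_{\mathcal{U}}(f;x,y)+\Sigma_{\mathcal{U}}(f;y+1,z)=\Sigma_{\mathcal{U}}(f;x,z)$; (A2) $\Sigma_{\mathcal{U}}(f;x+s,y+s)=\Sigma_{\mathcal{U}}(h;x,y)$ where $h(t)=f(t+s)$; (A3) $\Sigma_{\mathcal{U}}(\lambda f+\mu g;x,y)=\lambda\Sigma_{\mathcal{U}}(f;x,y)+\mu\Sigma_{\mathcal{U}}(g;x,y)$; (A4) $\Sigma_{\mathcal{U}}(f;1,1)=f(1)$; (A5* ) if $f$ is holomorphic, then $x\mapsto\Sigma_{\mathcal{U}}(f;1,x)$ is holomorphic on $\mathbb{C}$; (A6) if $\lim_{n\to\infty}f(t+n)=0$ for every $t\in\mathbb{C}$, then $\lim_{n\to\infty}\Sigma_{\mathcal{U}}(f(\cdot+n);x,y)=0$; moreover, if there is a sequence $(p_n)$ of polynomials of fixed degree (independent of $n$) with $|f(t+n)-p_n(t+n)|\to0$ for all $t\in\mathbb{C}$, then $\Sigma_{\mathcal{U}}(f(\cdot+n);x,y)$ minus the fractional sum of the polynomial $p_n(\cdot+n)$ from $x$ to $y$ tends to $0$ as $n\to\infty$. The map $\Sigma_{\mathcal{U}}$ is called the fractional sum relative to $\mathcal{U}$. Essence. For $f\in\mathbf{S}(\mathcal{U})$, the essence of $f$ relative to $\mathcal{U}$ is $\mathrm{ess}(f):=\lim_{h\to0}\frac1h\Sigma_{\mathcal{U}}(f;1,h)$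 ($h\in\mathbb{C}\setminus\{0\}$), if the limit exists; then $f$ is said to be a function with essence in $\mathcal{U}$. *)

(* Defs.v *)
From HB Require Import structures.
From mathcomp Require Import all_boot all_order all_algebra.
From mathcomp Require Import complex.
From mathcomp Require Import all_classical all_reals all_analysis.

Set Implicit Arguments.
Unset Strict Implicit.
Unset Printing Implicit Defensive.

Import Order.TTheory GRing.Theory Num.Theory.
Import numFieldNormedType.Exports.

Local Open Scope classical_set_scope.
Local Open Scope ring_scope.

(* The definitions below are parametrised by a [numClosedFieldType], because
   this is the structure that carries the norm topology in the library; they
   are meant to be used at [complexField R]. *)
Definition complexField (R : realType) : numClosedFieldType := R[i].

Section FractionalSums.
Variable C : numClosedFieldType.
Implicit Types (f g : C -> C) (X U : set (C -> C)) (p q : {poly C}).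
Implicit Types (x y z s t : C).

(* [derivable f z 1] is the existence of the limit of (f (z + h) - f z) / h as
   h tends to 0 in C, h != 0, that is, complex differentiability. *)
Definition entire f : Prop := forall z, derivable f z 1.

Definition lin_combs X : set (C -> C) :=
  [set f | exists (n : nat) (c : 'I_n -> C) (g : 'I_n -> C -> C),
      (forall i, X (g i)) /\ f = (fun x => \sum_(i < n) c i * g i x)].

Definition translates X : set (C -> C) :=
  [set f | exists (g : C -> C) (c : C), X g /\ f = (fun x => g (x + c))].

Definition translate_span X : set (C -> C) := lin_combs (translates X).

Definition is_sum_poly p (P : {poly C}) : Prop :=
  (forall z, P.[z] - P.[z - 1] = p.[z]) /\ P.[0] = 0.

(* Existence and uniqueness are [sum_polyP] and [sum_poly_uniq]. *)
Definition sum_poly p : {poly C} := xget 0 [set P | is_sum_poly p P].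

Definition poly_sum p x y : C := (sum_poly p).[y] - (sum_poly p).[x - 1].

(* [size q <= m.+1] means that [q] has degree at most [m] or is null. *)
Definition fractional_summable f : Prop :=
  exists (m : nat) (p : nat -> {poly C}),
    [/\ forall n, (size (p n) <= m.+1)%N,
        forall x, `|f (n%:R + x) - (p n).[n%:R + x]| @[n --> \oo] --> (0 : C) &
        forall x y,
          cvg ((poly_sum (p n) (n%:R + x) (n%:R + y)
                + \sum_(1 <= v < n.+1) (f (v%:R + x - 1) - f (v%:R + y)))
               @[n --> \oo])].

Definition classF : set (C -> C) :=
  lin_combs [set f | entire f \/ fractional_summable f].

(* Maps on [translate_span U] are represented by total maps on [C -> C], and
   only their values on [translate_span U] are constrained. *)
Record fractional_sum_axioms U (Sg : (C -> C) -> C -> C -> C) : Prop := {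
  fs_concat : forall f, translate_span U f -> forall x y z,
    Sg f x y + Sg f (y + 1) z = Sg f x z;
  fs_shift : forall f, translate_span U f -> forall x y s,
    Sg f (x + s) (y + s) = Sg (fun t => f (t + s)) x y;
  fs_linear : forall f g, translate_span U f -> translate_span U g ->
    forall (l m : C) x y,
    Sg (fun t => l * f t + m * g t) x y = l * Sg f x y + m * Sg g x y;
  fs_one : forall f, translate_span U f -> Sg f 1 1 = f 1;
  fs_entire : forall f, translate_span U f -> entire f ->
    entire (fun x => Sg f 1 x);
  fs_vanishing : forall f, translate_span U f ->
    (forall t, f (t + n%:R) @[n --> \oo] --> (0 : C)) ->
    forall x y, Sg (fun t => f (t + n%:R)) x y @[n --> \oo] --> (0 : C);
  (* All the [p n] have one and the same degree; the null polynomial, of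
     degree -oo, is the case d = 0. *)
  fs_asymptotic : forall f, translate_span U f ->
    forall (p : nat -> {poly C}) (d : nat),
    (forall n, size (p n) = d) ->
    (forall t, `|f (t + n%:R) - (p n).[t + n%:R]| @[n --> \oo] --> (0 : C)) ->
    forall x y,
      Sg (fun t => f (t + n%:R)) x y
      - poly_sum (p n \Po ('X + n%:R%:P)) x y @[n --> \oo] --> (0 : C)
}.

Definition summable_set U : Prop :=
  U `<=` classF /\
  exists Sg, fractional_sum_axioms U Sg /\
    forall Sg', fractional_sum_axioms U Sg' ->
      forall f, translate_span U f -> forall x y, Sg' f x y = Sg f x y.

Definition frac_sum U : (C -> C) -> C -> C -> C :=
  xget (fun _ _ _ => 0) [set Sg | fractional_sum_axioms U Sg].

Definition has_essence U f : Prop := cvg (h^-1 * frac_sum U f 1 h @[h --> 0^']).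

Definition essence U f : C := lim (h^-1 * frac_sum U f 1 h @[h --> 0^']).

(* The Riemann zeta function at the integers s >= 2, where it is given by its
   Dirichlet series; not meaningful for s = 0 and s = 1. *)
Definition zeta (s : nat) : C := limn (series (fun k => 1 / k.+1%:R ^+ s : C)).

Definition inv_pow (a : nat) x : C := if x == 0 then 0 else 1 / x ^+ a.

Definition inv_pow' (a : nat) x : C :=
  if x == 0 then 0 else - (a%:R / x ^+ a.+1).

Definition neg_integers : set C := [set x | exists k : nat, x = - k.+1%:R].

Lemma sum_poly_uniq p (P Q : {poly C}) :
  is_sum_poly p P -> is_sum_poly p Q -> P = Q.
Proof.
move=> [eP P0] [eQ Q0]; apply/eqP; rewrite -subr_eq0; apply/eqP.
pose D := P - Q.
have Dn (n : nat) : root D n%:R.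
  rewrite /root; elim: n => [|n IHn]; first by rewrite hornerD hornerN P0 Q0 subrr.
  have := eP n.+1%:R; rewrite -(eQ n.+1%:R) mulrSr addrK -mulrSr => e.
  move: IHn; rewrite !hornerD !hornerN => /eqP IHn.
  rewrite (_ : _ - _ = P.[n%:R] - Q.[n%:R]) ?IHn //.
  have -> : P.[n.+1%:R] = Q.[n.+1%:R] - Q.[n%:R] + P.[n%:R] by rewrite -e subrK.
  by rewrite addrC -[Q.[n.+1%:R] - _ + _]addrA addKr addrC.
apply: (@roots_geq_poly_eq0 _ D [seq n%:R | n <- iota 0 (size D)]).
- by apply/allP => _ /mapP[n _ ->].
- by rewrite map_inj_uniq ?iota_uniq // => i j /eqP; rewrite eqr_nat => /eqP.
- by rewrite size_map size_iota.
Qed.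

Lemma sum_polyP p : is_sum_poly p (sum_poly p).
Proof.
have comb (a : C) p1 p2 P1 P2 : is_sum_poly p1 P1 -> is_sum_poly p2 P2 ->
    is_sum_poly (a *: p1 + p2) (a *: P1 + P2).
  move=> [e1 z1] [e2 z2]; split=> [z|]; rewrite !hornerE ?z1 ?z2 ?mulr0 ?addr0 //.
  by rewrite -e1 -e2 mulrBr opprD addrACA.
have zero : is_sum_poly 0 0 by split=> [z|]; rewrite !horner0 ?subr0.
have mono (n : nat) : exists P, is_sum_poly 'X^n P.
  elim/ltn_ind: n => n IH.
  have [P HP] : exists P, is_sum_poly
      (\sum_(i < n) ((- 1) ^+ (n - i) * 'C(n.+1, i)%:R) *: 'X^i) P.
    elim/big_ind: _ => [|p1 p2 [P1 H1] [P2 H2]|i _]; first by exists 0.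
      by exists (1 *: P1 + P2); rewrite -[p1]scale1r; exact: comb.
    have [P HP] := IH i (ltn_ord i).
    by exists (((- 1) ^+ (n - i) * 'C(n.+1, i)%:R) *: P + 0); rewrite -[_ *: _]addr0; exact: comb.
  have base : is_sum_poly ('X^(n.+1) - ('X - 1) ^+ n.+1) 'X^(n.+1).
    by split=> [z|]; rewrite !hornerE ?horner_exp ?hornerE ?expr0n.
  have n1 : (n.+1%:R : C) != 0 by rewrite pnatr_eq0.
  exists (n.+1%:R^-1 *: (-1 *: P + 'X^(n.+1)) + 0).
  rewrite [X in is_sum_poly X _](_ : _ = n.+1%:R^-1 *: (-1 *:
    (\sum_(i < n) ((- 1) ^+ (n - i) * 'C(n.+1, i)%:R) *: 'X^i)
    + ('X^(n.+1) - ('X - 1) ^+ n.+1)) + 0); first by apply: (comb _ _ _ _ _ _ zero); exact: comb.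
  rewrite addr0 scaleN1r.
  have -> : ('X^(n.+1) : {poly C}) - ('X - 1) ^+ n.+1
      = \sum_(i < n.+1) ((- 1) ^+ (n - i) * 'C(n.+1, i)%:R) *: 'X^i.
    rewrite ['X - 1]addrC exprDn_comm; last exact: (@mulrC {poly C}).
    rewrite big_ord_recr /= subnn expr0 mul1r binn mulr1n opprD addrCA subrr addr0.
    rewrite -sumrN; apply: eq_bigr => i _.
    have le_in : (i <= n)%N by rewrite -ltnS ltn_ord.
    rewrite (subSn le_in) exprS mulN1r mulNr mulNrn opprK.
    by rewrite -mul_polyC polyCM polyC_exp polyCN polyC1 polyC_natr mulrAC mulr_natr.
  rewrite big_ord_recr /= addKr subnn expr0 mul1r binSn scalerA.
  by rewrite mulVf // scale1r.
rewrite /sum_poly; apply: (@xgetPex _ 0 [set P | is_sum_poly p P]).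
rewrite /= -[p]coefK poly_def.
elim/big_ind: _ => [|p1 p2 [P1 H1] [P2 H2]|i _]; first by exists 0.
  by exists (1 *: P1 + P2); rewrite -[p1]scale1r; exact: comb.
have [P HP] := mono i.
by exists (p`_i *: P + 0); rewrite -[_ *: _]addr0; exact: comb.
Qed.

End FractionalSums.

(* Main.v *)
(* For a summable f that vanishes along every t + n, axioms (A1), (A2), (A4) and
   (A6) force Sigma(f; x, y) = lim_n sum_(k < n) (f (x + k) - f (y + 1 + k)).
   Hence Sigma(f_a; 1, x + h) - Sigma(f_a; 1, x) = Sigma(f_a; x + 1, x + h) is a
   series of increments of f_a, whose first-order part in h is h times
   a zeta(a+1) + Sigma(f_a'; 1, x).  The k-th remainder is at most
   K |h|^2 / (k+1)^2, because |x + 1 + k| >= d (k + 1) for some d > 0 when x is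
   not a negative integer, so the whole remainder is O(|h|^2).  The essence is
   the derivative at x = 0. *)
Require Import Defs.
From HB Require Import structures.
From mathcomp Require Import all_boot all_order all_algebra.
From mathcomp Require Import complex ring.
From mathcomp Require Import all_classical all_reals all_analysis.

Set Implicit Arguments.
Unset Strict Implicit.
Unset Printing Implicit Defensive.

Import Order.TTheory GRing.Theory Num.Theory.
Import numFieldNormedType.Exports.

Local Open Scope classical_set_scope.
Local Open Scope ring_scope.

(** * Fractional sums of functions that vanish along every [t + n] *)

Section FractionalSumOfVanishing.
Variables (C : numClosedFieldType) (U : set (C -> C)).
Variable Sg : (C -> C) -> C -> C -> C.
Hypothesis HSg : fractional_sum_axioms U Sg.

Lemma translate_span_shift f s :
  translate_span U f -> translate_span U (fun t => f (t + s)).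
Proof.
move=> [n [c [g [Tg ->]]]]; exists n, c, (fun i t => g i (t + s)).
split=> // i; have [g0 [d [Ug0 ->]]] := Tg i.
by exists g0, (s + d); split=> //; apply/funext => t; rewrite addrA.
Qed.

Lemma frac_sum_diag f x : translate_span U f -> Sg f x x = f x.
Proof.
move=> Uf; rewrite -[in LHS](subrK 1 x) addrC (fs_shift HSg) //.
rewrite (fs_one HSg); last exact: translate_span_shift.
by rewrite addrC subrK.
Qed.

(** Axiom (A1) splits the sum from [u] to [v + 1] after its first term and before its last one;
    comparing the two splittings moves both bounds by 1, and iteration telescopes. *)
Lemma frac_sum_shift_diff f x y n : translate_span U f ->
  Sg f x y - Sg f (x + n%:R) (y + n%:R)
    = \sum_(0 <= k < n) (f (x + k%:R) - f (y + 1 + k%:R)).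
Proof.
move=> Uf.
have step u v : Sg f u v = Sg f (u + 1) (v + 1) + (f u - f (v + 1)).
  have e1 := fs_concat HSg Uf u u (v + 1).
  have e2 := fs_concat HSg Uf u v (v + 1).
  rewrite frac_sum_diag // in e1; rewrite frac_sum_diag // in e2.
  by apply: (addIr (f (v + 1))); rewrite e2 -e1 addrA subrK addrC.
elim: n => [|n IHn]; first by rewrite !addr0 subrr big_geq.
rewrite big_nat_recr //= -IHn [Sg f (x + n%:R) _]step -natr1 !addrA.
by rewrite [y + 1 + _]addrAC; ring.
Qed.

Lemma frac_sum_cvg f x y : translate_span U f ->
  (forall t, f (t + n%:R) @[n --> \oo] --> (0 : C)) ->
  \sum_(0 <= k < n) (f (x + k%:R) - f (y + 1 + k%:R)) @[n --> \oo]
    --> Sg f x y.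
Proof.
move=> Uf f0.
have -> : (fun n => \sum_(0 <= k < n) (f (x + k%:R) - f (y + 1 + k%:R)))
    = (fun n => Sg f x y - Sg (fun t => f (t + n%:R)) x y).
  by apply/funext => n; rewrite -frac_sum_shift_diff // (fs_shift HSg).
have := cvgB (cvg_cst (Sg f x y)) (fs_vanishing HSg Uf f0 x y).
by rewrite subr0; apply.
Qed.

Lemma frac_sum_10 f : translate_span U f -> Sg f 1 0 = 0.
Proof.
move=> Uf; have := fs_concat HSg Uf 1 0 0; rewrite add0r.
by move/eqP; rewrite -subr_eq0 addrK => /eqP.
Qed.

End FractionalSumOfVanishing.

(** Since the sum from 1 to 0 is empty, the quotient that defines the essence is the difference
    quotient at 0. *)
Lemma essence_is_derive (C : numClosedFieldType) (U : set (C -> C))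
    (f : C -> C) (l : C) :
  fractional_sum_axioms U (frac_sum U) -> translate_span U f ->
  is_derive (0 : C) 1 (fun y => frac_sum U f 1 y) l ->
  has_essence U f /\ essence U f = l.
Proof.
move=> HS Uf dF.
have dq : (fun h => h^-1 *: (frac_sum U f 1 (h *: 1 + 0) - frac_sum U f 1 0))
    = (fun h => h^-1 * frac_sum U f 1 h).
  apply/funext => h.
  by rewrite (frac_sum_10 HS Uf) subr0 addr0 [h *: 1]mulr1.
split.
  by have := @ex_derive _ _ _ _ _ _ _ dF; rewrite /derivable /= dq.
by have := @derive_val _ _ _ _ _ _ _ dF; rewrite /derive /= dq.
Qed.

(** * Norm estimates and a quadratic criterion for derivatives *)

Section Estimates.
Variable C : numFieldType.
Implicit Types (u v w h : C).

Lemma norm_lim_le (s : nat -> C) (l B : C) :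
  (forall n, `|s n| <= B) -> s n @[n --> \oo] --> l -> `|l| <= B.
Proof.
(* The order on [C] is partial: negating an inequality needs both sides real, and [B] is real
   because it is nonnegative. *)
move=> sB sl; have B0 : 0 <= B := le_trans (normr_ge0 _) (sB 0%N).
rewrite real_leNgt ?normr_real ?ger0_real //; apply/negP => Bl.
have /cvgrPdist_lt /(_ (`|l| - B)) := sl.
rewrite subr_gt0 => /(_ Bl) [n _ /(_ n (leqnn n)) /=].
apply/negP; rewrite -real_leNgt ?normr_real ?realB ?normr_real ?ger0_real //.
rewrite lerBlDr -lerBlDl.
rewrite (le_trans _ (sB n)) // lerBlDr.
by rewrite -{1}(subrK (s n) l) addrC ler_normD.
Qed.

Lemma sum_inv_sqr_le n : \sum_(0 <= k < n) (k.+1%:R ^- 2 : C) <= 2.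
Proof.
(* The correction 2/(n+1) makes the induction close: 1/(n+1)^2 <= 2/(n+1) - 2/(n+2). *)
suff : \sum_(0 <= k < n) (k.+1%:R ^- 2 : C) <= 2 - 2 / n.+1%:R.
  by move/le_trans; apply; rewrite gerBl divr_ge0.
elim: n => [|n IHn]; first by rewrite big_geq // divr1 subrr.
rewrite big_nat_recr //=; apply: (le_trans (lerD IHn (lexx _))).
have n1 : 0 < n.+1%:R :> C by rewrite ltr0n.
have n2 : 0 < n.+2%:R :> C by rewrite ltr0n.
rewrite -subr_ge0.
have -> : 2 - 2 / n.+2%:R - (2 - 2 / n.+1%:R + n.+1%:R ^- 2)
    = n%:R / (n.+1%:R ^+ 2 * n.+2%:R) :> C.
  rewrite -[n.+2%:R]natr1 -[n.+1%:R]natr1; field.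
  by rewrite !natr1 !pnatr_eq0.
by rewrite divr_ge0 // mulr_ge0 // exprn_ge0 // ltW.
Qed.

Section InversePowers.
Variables (u h B : C).
Hypotheses (u0 : u != 0) (uh0 : u + h != 0).
Hypotheses (uB : `|u^-1| <= B) (uhB : `|(u + h)^-1| <= B).

Let v := u^-1.
Let w := (u + h)^-1.

Let subvw : v - w = h * v * w.
Proof. by rewrite /v /w; field; apply/andP. Qed.

Lemma norm_subX_inv_le m : `|v ^+ m - w ^+ m| <= m%:R * B ^+ m.+1 * `|h|.
Proof.
have B0 : 0 <= B := le_trans (normr_ge0 _) uB.
elim: m => [|m IHm]; first by rewrite subrr normr0 !mul0r.
have -> : v ^+ m.+1 - w ^+ m.+1 = v * (v ^+ m - w ^+ m) + w ^+ m * (v - w).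
  by rewrite !exprS; ring.
have -> : m.+1%:R * B ^+ m.+2 * `|h|
    = B * (m%:R * B ^+ m.+1 * `|h|) + B ^+ m * (`|h| * B * B).
  by rewrite -natr1 !exprS; ring.
rewrite (le_trans (ler_normD _ _)) // subvw !normrM normrX.
rewrite lerD ?ler_pM ?mulr_ge0 ?exprn_ge0 //.
by rewrite lerXn2r ?nnegrE.
Qed.

(** This is the first-order Taylor remainder of the m-th inverse power at [u]. The constant m^2
    suits the induction because m^2 + (m+1) <= (m+1)^2. *)
Lemma norm_inv_taylor_le m :
  `|v ^+ m - w ^+ m - m%:R * h * v ^+ m.+1|
    <= m%:R ^+ 2 * B ^+ m.+2 * `|h| ^+ 2.
Proof.
have B0 : 0 <= B := le_trans (normr_ge0 _) uB.
elim: m => [|m IHm]; first by rewrite subrr !mul0r subrr normr0 expr0n !mul0r.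
have -> : v ^+ m.+1 - w ^+ m.+1 - m.+1%:R * h * v ^+ m.+2
    = v * (v ^+ m - w ^+ m - m%:R * h * v ^+ m.+1)
      + h * v * (w ^+ m.+1 - v ^+ m.+1).
  (* The decomposition holds only modulo [subvw], so a vanishing multiple of that relation is
     subtracted before [ring]. *)
  have e : w ^+ m * (v - w - h * v * w) = 0 by rewrite subvw subrr mulr0.
  by rewrite -[LHS]subr0 -e -natr1 !exprS; ring.
rewrite (le_trans (ler_normD _ _)) // !normrM.
have le1 : `|v| * `|v ^+ m - w ^+ m - m%:R * h * v ^+ m.+1|
    <= B * (m%:R ^+ 2 * B ^+ m.+2 * `|h| ^+ 2) by rewrite ler_pM.
have le2 : `|h| * `|v| * `|w ^+ m.+1 - v ^+ m.+1|
    <= `|h| * B * (m.+1%:R * B ^+ m.+2 * `|h|).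
  by rewrite ler_pM ?mulr_ge0 ?ler_pM // distrC norm_subX_inv_le.
rewrite (le_trans (lerD le1 le2)) // -subr_ge0.
have -> : m.+1%:R ^+ 2 * B ^+ m.+3 * `|h| ^+ 2
    - (B * (m%:R ^+ 2 * B ^+ m.+2 * `|h| ^+ 2)
       + `|h| * B * (m.+1%:R * B ^+ m.+2 * `|h|))
    = m%:R * B ^+ m.+3 * `|h| ^+ 2 by rewrite -natr1 !exprS; ring.
by rewrite mulr_ge0 ?exprn_ge0 // mulr_ge0 ?exprn_ge0.
Qed.

End InversePowers.

Lemma is_derive_quadratic (F : C -> C) (x l K d : C) : 0 < d ->
  (forall h, `|h| <= d -> `|F (x + h) - F x - h * l| <= K * `|h| ^+ 2) ->
  is_derive x 1 F l.
Proof.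
move=> d0 FK.
have K0 : 0 <= K.
  have dd : `|d| <= d by rewrite (ger0_norm (ltW d0)).
  have := le_trans (normr_ge0 _) (FK d dd).
  by rewrite pmulr_lge0 // exprn_gt0 // normr_gt0 gt_eqF.
(* [K] may be 0; dividing by [K + 1] keeps the radius below well defined. *)
have K1 : 0 < K + 1 by rewrite ltr_wpDl.
have Fl : h^-1 *: (F (h *: 1 + x) - F x) @[h --> 0^'] --> l.
  apply/cvgrPdist_le => e e0; near=> h.
  have h0 : h != 0 by near: h; exact: nbhs_dnbhs_neq.
  have hd : `|h| <= d by near: h; exact: dnbhs0_le.
  have he : `|h| <= e / (K + 1) by near: h; apply: dnbhs0_le; rewrite divr_gt0.
  rewrite distrC.
  have -> : h^-1 *: (F (h *: 1 + x) - F x) - l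
      = h^-1 * (F (x + h) - F x - h * l).
    by rewrite [h *: 1]mulr1 [h + x]addrC mulrBr mulKf.
  rewrite normrM normfV ler_pdivrMl ?normr_gt0 //.
  rewrite (le_trans (FK _ hd)) // expr2 mulrCA ler_wpM2l //.
  move: he; rewrite ler_pdivlMr // => he.
  by rewrite (le_trans _ he) // mulrC ler_wpM2l // lerDl.
by apply: DeriveDef; [exact: cvgP Fl|exact/cvg_lim].
Unshelve. all: by end_near.
Qed.

(** Positive elements are real, hence comparable, so this replaces a minimum in the partial
    order. *)
Lemma pos_lower_bound (d e : C) : 0 < d -> 0 < e ->
  exists2 c, 0 < c & c <= d /\ c <= e.
Proof.
move=> d0 e0; have [de|/ltW ed] := real_leP (gtr0_real d0) (gtr0_real e0).
  by exists d.
by exists e.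
Qed.

Lemma ler_norm_addn (t : C) n : n%:R - `|t| <= `|t + n%:R|.
Proof. by rewrite [t + _]addrC -{1}(normr_nat C n) lerB_normD. Qed.

End Estimates.

(** * Inverse powers and the derivative of their fractional sums *)

Section InversePowerFunctions.
Variable C : numClosedFieldType.
Hypothesis archi : forall z : C, exists n : nat, `|z| < n%:R.
Implicit Types (x t h : C).

(** Once k >= N > 2|x|, the triangle inequality gives the factor 1/2. The finitely many smaller k
    give nonzero values, as x is not a negative integer, and a positive lower bound for their ratios
    is built by induction. *)
Lemma norm_nat_shift_ge x : ~ neg_integers x ->
  exists2 d : C, 0 < d & forall k, d * k.+1%:R <= `|x + 1 + k%:R|.
Proof.
move=> xN.
have fin N : exists2 d : C, 0 < d &
    forall k, (k < N)%N -> d * k.+1%:R <= `|x + 1 + k%:R|.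
  elim: N => [|N [d d0 dN]]; first by exists 1.
  have e0 : 0 < `|x + 1 + N%:R| / N.+1%:R.
    rewrite divr_gt0 ?ltr0n // normr_gt0 -addrA nat1r addr_eq0.
    by apply/eqP => xE; apply: xN; exists N.
  have [c c0 [cd ce]] := pos_lower_bound d0 e0.
  exists c => // k; rewrite ltnS leq_eqVlt => /predU1P[->|/dN le_k].
    by rewrite -ler_pdivlMr ?ltr0n.
  by rewrite (le_trans _ le_k) // ler_wpM2r.
have [N xlt] := archi (2 * x).
have [d d0 dN] := fin N.
have h0 : 0 < 2^-1 :> C by rewrite invr_gt0.
have [c c0 [cd ce]] := pos_lower_bound d0 h0.
exists c => // k; have [/dN le_k|Nk] := ltnP k N.
  by rewrite (le_trans _ le_k) // ler_wpM2r.
rewrite (@le_trans _ _ (2^-1 * k.+1%:R)) ?ler_wpM2r //.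
rewrite (@le_trans _ _ (k.+1%:R - `|x|)) //.
  rewrite lerBrDr -lerBrDl.
  have -> : k.+1%:R - 2^-1 * k.+1%:R = 2^-1 * k.+1%:R :> C by field.
  rewrite mulrC ler_pdivlMr // mulrC -{1}[2]ger0_norm // -normrM.
  by rewrite (le_trans (ltW xlt)) // ler_nat ltnW.
by rewrite -addrA nat1r; exact: ler_norm_addn.
Qed.

Lemma inv_pow_vanishing m t : (0 < m)%N ->
  inv_pow m (t + n%:R) @[n --> \oo] --> (0 : C).
Proof.
move=> m0; apply/cvgrPdist_lt => e e0.
have ei0 : 0 <= e^-1 by rewrite invr_ge0 ltW.
have s0 : 0 <= e^-1 + 1 + `|t| by rewrite !addr_ge0.
have [N] := archi (e^-1 + 1 + `|t|).
rewrite ger0_norm // => ltN; exists N => // n /= Nn.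
(* Exceeding 1 excludes the default value at 0 and bounds every power of the inverse by the inverse
   itself; exceeding [e^-1] makes that smaller than [e]. *)
have lt_u : e^-1 + 1 < `|t + n%:R|.
  rewrite (@lt_le_trans _ _ (n%:R - `|t|)) //.
    by rewrite ltrBrDr (lt_le_trans ltN) // ler_nat.
  exact: ler_norm_addn.
have u_gt1 : 1 < `|t + n%:R| by rewrite (le_lt_trans _ lt_u) // lerDr.
have u_gt0 : 0 < `|t + n%:R| by rewrite (lt_trans _ u_gt1).
rewrite /inv_pow sub0r normrN ifN; last by rewrite -normr_gt0.
rewrite div1r normfV normrX -exprVn.
rewrite (@le_lt_trans _ _ `|t + n%:R|^-1) //.
  by rewrite ler_iXnr // invf_le1 // ltW.
rewrite -[e]invrK ltf_pV2 ?posrE ?invr_gt0 //.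
by rewrite (lt_trans _ lt_u) // ltrDl.
Qed.

Lemma inv_pow'E m : inv_pow' m = (fun t => - m%:R * inv_pow m.+1 t).
Proof.
apply/funext => t; rewrite /inv_pow' /inv_pow; case: ifP => _.
  by rewrite mulr0.
by rewrite mulNr mul1r.
Qed.

Section Derivative.
Variables (U : set (C -> C)) (Sg : (C -> C) -> C -> C -> C) (a : nat) (Z : C).
Hypothesis HSg : fractional_sum_axioms U Sg.
Hypothesis a0 : (0 < a)%N.
Hypothesis Uf : translate_span U (inv_pow a).
Hypothesis Uf' : translate_span U (inv_pow' a).
Hypothesis ZE :
  series (fun k => 1 / k.+1%:R ^+ a.+1 : C) n @[n --> \oo] --> Z.

(** As f_a' = -a f_(a+1), the partial sums for [Sg (inv_pow' a) 1 x] contain -a/(k+1)^(a+1), which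
    the series of [a%:R * Z] cancels. *)
Lemma inv_pow_deriv_series x :
  \sum_(0 <= k < n) (a%:R * inv_pow a.+1 (x + 1 + k%:R)) @[n --> \oo]
    --> a%:R * Z + Sg (inv_pow' a) 1 x.
Proof.
have v t : inv_pow' a (t + n%:R) @[n --> \oo] --> (0 : C).
  rewrite inv_pow'E -[X in _ --> X](mulr0 (- a%:R : C)).
  by apply: cvgM; [exact: cvg_cst|exact: inv_pow_vanishing].
have c1 := @frac_sum_cvg _ _ _ HSg _ 1 x Uf' v.
have c2 : a%:R * series (fun k => 1 / k.+1%:R ^+ a.+1 : C) n @[n --> \oo]
    --> a%:R * Z.
  by apply: cvgM; [exact: cvg_cst|exact: ZE].
have -> : (fun n => \sum_(0 <= k < n) (a%:R * inv_pow a.+1 (x + 1 + k%:R)))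
  = (fun n => a%:R * series (fun k => 1 / k.+1%:R ^+ a.+1 : C) n
    + \sum_(0 <= k < n) (inv_pow' a (1 + k%:R) - inv_pow' a (x + 1 + k%:R))).
  apply/funext => n.
  rewrite /series /= mulr_sumr -big_split /=; apply: eq_bigr => k _.
  rewrite inv_pow'E [inv_pow _ (1 + _)]/inv_pow nat1r pnatr_eq0 /=.
  by ring.
exact: cvgD.
Qed.

(** Moving u by at most d/2 leaves |u + h| >= (d/2)(k+1), so [norm_inv_taylor_le] applies with B =
    2/(d(k+1)). Of the factor (k+1)^-(a+2), only the summable (k+1)^-2 is kept. *)
Lemma inv_pow_taylor_le x d h k : 0 < d -> `|h| <= d / 2 ->
  d * k.+1%:R <= `|x + 1 + k%:R| ->
  `|inv_pow a (x + 1 + k%:R) - inv_pow a (x + h + 1 + k%:R)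
     - h * (a%:R * inv_pow a.+1 (x + 1 + k%:R))|
    <= a%:R ^+ 2 * (2 / d) ^+ a.+2 * `|h| ^+ 2 * k.+1%:R ^- 2.
Proof.
move=> d0 hd dle; set u := x + 1 + k%:R.
have -> : x + h + 1 + k%:R = u + h by rewrite /u; ring.
have k0 : 0 < k.+1%:R :> C by rewrite ltr0n.
have d20 : 0 < d / 2 by rewrite divr_gt0.
have B0 : 0 < d / 2 * k.+1%:R by rewrite mulr_gt0.
have uhle : d / 2 * k.+1%:R <= `|u + h|.
  apply: (@le_trans _ _ (`|u| - `|h|)); last exact: lerB_normD.
  rewrite lerBrDr (le_trans _ dle) //.
  have -> : d * k.+1%:R = d / 2 * k.+1%:R + d / 2 * k.+1%:R by field.
  by rewrite lerD2l (le_trans hd) // ler_peMr ?ler1n // ltW.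
have ule : d / 2 * k.+1%:R <= `|u|.
  rewrite (le_trans _ dle) // ler_pM2r // ler_pdivrMr //.
  by rewrite ler_peMr ?ler1n // ltW.
have u0 : u != 0 by rewrite -normr_gt0 (lt_le_trans B0).
have uh0 : u + h != 0 by rewrite -normr_gt0 (lt_le_trans B0).
have := @norm_inv_taylor_le _ u h (2 / d / k.+1%:R) u0 uh0.
have BE : (d / 2 * k.+1%:R)^-1 = 2 / d / k.+1%:R.
  by rewrite mulrC invfM invf_div mulrC.
rewrite -BE.
rewrite !normfV !lef_pV2 ?posrE ?normr_gt0 // => /(_ ule uhle a).
rewrite /inv_pow (negbTE u0) (negbTE uh0) !div1r.
rewrite ![u^-1 ^+ _]exprVn ![(u + h)^-1 ^+ _]exprVn.
rewrite [h * (_ * _)]mulrCA mulrA => /le_trans; apply.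
have P0 : 0 <= (2 / d) ^+ a.+2 by rewrite exprn_ge0 // divr_ge0 // ltW.
have Qk : k.+1%:R^-1 ^+ a.+2 <= k.+1%:R ^- 2 :> C.
  rewrite exprVn lef_pV2 ?posrE ?exprn_gt0 //.
  by rewrite -!natrX ler_nat leq_pexp2l.
rewrite BE exprMn; move: P0 Qk.
move: ((2 / d) ^+ a.+2) (k.+1%:R^-1 ^+ a.+2) => P Q P0 Qk.
have -> : a%:R ^+ 2 * (P * Q) * `|h| ^+ 2 = a%:R ^+ 2 * P * `|h| ^+ 2 * Q.
  by ring.
by rewrite ler_wpM2l // mulr_ge0 ?exprn_ge0 // mulr_ge0 ?exprn_ge0.
Qed.

Lemma is_derive_frac_sum_inv_pow x : ~ neg_integers x ->
  is_derive x 1 (fun y => Sg (inv_pow a) 1 y)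
    (a%:R * Z + Sg (inv_pow' a) 1 x).
Proof.
move=> /norm_nat_shift_ge [d d0 dle].
(* The last factor 2 is the bound of [sum_inv_sqr_le]. *)
apply: (@is_derive_quadratic _ _ _ _
  (a%:R ^+ 2 * (2 / d) ^+ a.+2 * 2) (d / 2)); first by rewrite divr_gt0.
move=> h hd.
have -> : Sg (inv_pow a) 1 (x + h) - Sg (inv_pow a) 1 x
    = Sg (inv_pow a) (x + 1) (x + h).
  by rewrite -(fs_concat HSg Uf 1 x) addrC addKr.
have v t : inv_pow a (t + n%:R) @[n --> \oo] --> (0 : C).
  exact: inv_pow_vanishing.
have c1 := @frac_sum_cvg _ _ _ HSg _ (x + 1) (x + h) Uf v.
have c2 : h * \sum_(0 <= k < n) (a%:R * inv_pow a.+1 (x + 1 + k%:R))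
    @[n --> \oo] --> h * (a%:R * Z + Sg (inv_pow' a) 1 x).
  by apply: cvgM; [exact: cvg_cst|exact: inv_pow_deriv_series].
(* The bound is uniform in n, so it is enough to prove it for partial sums. *)
apply: (norm_lim_le _ (cvgB c1 c2)) => n.
rewrite !fctE mulr_sumr -sumrB (le_trans (ler_norm_sum _ _ _)) //.
apply: (@le_trans _ _ (a%:R ^+ 2 * (2 / d) ^+ a.+2 * `|h| ^+ 2 *
    \sum_(0 <= k < n) k.+1%:R ^- 2)).
  by rewrite mulr_sumr ler_sum // => k _; exact: inv_pow_taylor_le.
rewrite [leRHS]mulrAC ler_wpM2l ?sum_inv_sqr_le //.
by rewrite mulr_ge0 ?exprn_ge0 // mulr_ge0 ?exprn_ge0 // divr_ge0 // ltW.
Qed.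

End Derivative.

End InversePowerFunctions.

(** * Archimedean property and convergence of the zeta series over the complex numbers *)

Section ComplexNumbers.
Variable R : realType.
Local Notation C := (complexField R).
Implicit Types (x z t : C).

Lemma norm_real_complex (r : R) : `|(r%:C)%C : C| = (`|r|%:C)%C.
Proof. by rewrite normc_def /= expr0n addr0 sqrtr_sqr. Qed.

Lemma complex_archi z : exists n : nat, `|z| < n%:R.
Proof.
rewrite normc_def; set r : R := Num.sqrt _.
exists (Num.truncn r).+1.
rewrite -(rmorph_nat (real_complex R)) ltcR.
exact: truncnS_gt.
Qed.

Lemma real_complex_cvg (s : nat -> R) (l : R) : s n @[n --> \oo] --> l ->
  (((s n)%:C)%C : C) @[n --> \oo] --> (((l%:C)%C : C)).
Proof.
move=> sl; apply/cvgrPdist_lt => e e0.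
(* A positive element of [C] is real, so the tolerance descends to [R]. *)
have eE : e = ((complex.Re e)%:C)%C by rewrite RRe_real // gtr0_real.
have Re0 : 0 < complex.Re e by move: e0; rewrite {1}eE ltcR.
move/cvgrPdist_lt : sl => /(_ _ Re0); apply: filterS => n sn.
by rewrite eE -rmorphB norm_real_complex ltcR.
Qed.

(** Monotone convergence is used over [R], with the bound 2 obtained by comparison with inverse
    squares; the limit is then transported to [C]. *)
Lemma zeta_cvg s : (2 <= s)%N ->
  series (fun k => 1 / k.+1%:R ^+ s : C) n @[n --> \oo] --> zeta C s.
Proof.
move=> s2.
pose r : nat -> R := series (fun k => k.+1%:R ^- s).
have /cvg_ex [l rl] : cvgn r.
  apply: nondecreasing_is_cvgn.
    by apply: nondecreasing_series => k _ _; rewrite invr_ge0 exprn_ge0.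
  exists 2 => _ [n _ <-]; apply: le_trans (sum_inv_sqr_le R n).
  apply: ler_sum => k _; rewrite lef_pV2 ?posrE ?exprn_gt0 ?ltr0n //.
  by rewrite -!natrX ler_nat leq_pexp2l.
have rE : series (fun k => 1 / k.+1%:R ^+ s : C) = (fun n => ((r n)%:C)%C).
  apply/funext => n; rewrite /r /series /= rmorph_sum /=.
  by apply: eq_bigr => k _; rewrite div1r fmorphV rmorphXn /= rmorph_nat.
have sl := real_complex_cvg rl.
by rewrite /zeta rE (cvg_lim _ sl).
Qed.

End ComplexNumbers.

Theorem theorem4p3p5 (R : realType) (a : nat) (ha : (1 <= a)%N)
    (U : set (complexField R -> complexField R)) (hU : summable_set U)
    (hf : [set inv_pow a; inv_pow' a] `<=` translate_span U) :
  [/\ has_essence U (inv_pow a),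
      essence U (inv_pow a) = a%:R * zeta (complexField R) a.+1 &
      forall x : complexField R, ~ neg_integers x ->
        is_derive x 1 (fun y : complexField R => frac_sum U (inv_pow a) 1 y)
          (essence U (inv_pow a) + frac_sum U (inv_pow' a) 1 x)].
Proof.
have [_ [Sg [HSg _]]] := hU.
have HS : fractional_sum_axioms U (frac_sum U).
  exact: (@xgetPex _ _ [set Sg | fractional_sum_axioms U Sg]
           (ex_intro _ Sg HSg)).
have Uf : translate_span U (inv_pow a) by apply: hf; left.
have Uf' : translate_span U (inv_pow' a) by apply: hf; right.
have dF := is_derive_frac_sum_inv_pow (@complex_archi R) HS ha Uf Uf'
  (@zeta_cvg R a.+1 ha).
have N0 : ~ neg_integers (0 : complexField R).
  by move=> [k /eqP]; rewrite eq_sym oppr_eq0 pnatr_eq0.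
(* At x = 0 the sum of f_a' is empty, so the derivative there is the zeta term alone. *)
have := dF 0 N0; rewrite (frac_sum_10 HS Uf') addr0.
case/(essence_is_derive HS Uf) => ess1 ess2.
split; [exact: ess1|exact: ess2|move=> x xN].
rewrite ess2; exact: dF.
Qed.
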